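(* Let $H$ be a real Hilbert space, $C\subseteq H$ nonempty, closed and convex, and let $I=\{1,\dots,N\}$, $J=\{1,\dots,M\}$. Let $f_i:C\times C\to\mathbb{R}$ ($i\in I$) be bifunctions such that, for every $i\in I$: (A1) $f_i$ is pseudomonotone on $C$ and $f_i(x,x)=0$ for all $x\in C$; (A2) $f_i$ is Lipschitz-type continuous on $C$ with constants $c_1,c_2>0$ (the same for all $i$); (A3) $\limsup_{n\to\infty} f_i(x_n,y)\le f_i(x,y)$ for every $y\in C$ and every sequence $\{x_n\}\subset C$ converging weakly to $x$; (A4) for every fixed $x\in C$, $f_i(x,\cdot)$ is convex and subdifferentiable on $C$. Let $S_j:C\to C$ ($j\in J$) be mappings which are $\beta$-demicontractive on $C$, with $\beta\in[0,1)$ the same for all $j$, and demiclosed at zero. Let $F:C\to H$ be $\eta$-strongly monotone and $L$-Lipschitz continuous ($\eta,L>0$). Suppose $$\Omega:=\Big(\bigcap_{i\in I}EP(f_i,C)\Big)\cap\Big(\bigcap_{j\in J}Fix(S_j)\Big)\neq\emptyset .$$ Let $\rho$, $\{\alpha_n\}$, $\{\beta_n^j\}$, $\{w_n^i\}$, $\{\gamma_n^j\}$ ($n\ge0$, $i\in I$, $j\in J$) be real parameters with $0<\rho<\min\{\frac1{2c_1},\frac1{2c_2}\}$; $\alpha_n>0$, $\lim_{n\to\infty}\alpha_n=0$, $\sum_{n=1}^\infty\alpha_n=+\infty$; $0<a\le\beta_n^j<\frac{1-\beta}{2}$ for all $n,j$, for some constant $a$; $w_n^i\in(0,1)$, $\sum_{i\in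 I}w_n^i=1$ for all $n$, and $\liminf_{n\to\infty}w_n^i>0$ for all $i\in I$; $\gamma_n^j\in(0,1)$, $\sum_{j\in J}\gamma_n^j=1$ for all $n$, and $\liminf_{n\to\infty}\gamma_n^j>0$ for all $j\in J$. Let $x_0\in C$ and let the sequence $\{x_n\}$ be generated, for $n=0,1,2,\dots$, by $$y_n^i=\operatorname{argmin}\{\rho f_i(x_n,y)+\tfrac12\|x_n-y\|^2: y\in C\},\quad i\in I,$$ $$z_n^i=\operatorname{argmin}\{\rho f_i(y_n^i,y)+\tfrac12\|x_n-y\|^2: y\in C\},\quad i\in I,$$ $$z_n=\sum_{i\in I}w_n^iz_n^i,\qquad t_n=z_n-\alpha_nF(z_n),\qquad x_{n+1}=\sum_{j\in J}\gamma_n^j\big[(1-\beta_n^j)t_n+\beta_n^jS_jt_n\big].$$ Then $\{x_n\}$ converges strongly to the unique solution $x^*$ of the variational inequality problem for $F$ on $\Omega$, i.e. the unique $x^*\in\Omega$ with $\langle F(x^* ),y-x^*\rangle\ge0$ for all $y\in\Omega$.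
   Context: Notation: $EP(f,C)=\{x\in C: f(x,y)\ge0\ \forall y\in C\}$ and $Fix(S)=\{x\in C: S(x)=x\}$. A bifunction $f:C\times C\to\mathbb{R}$ is pseudomonotone on $C$ if $f(x,y)\ge0\Rightarrow f(y,x)\le0$ for all $x,y\in C$. It is Lipschitz-type continuous on $C$ with constants $c_1,c_2>0$ if $f(x,y)+f(y,z)\ge f(x,z)-c_1\|x-y\|^2-c_2\|y-z\|^2$ for all $x,y,z\in C$. A convex function $g:C\to\mathbb{R}$ is subdifferentiable on $C$ if for every $y\in C$ there is $w\in H$ with $g(z)\ge g(y)+\langle w,z-y\rangle$ for all $z\in C$. A mapping $S:C\to C$ is $\beta$-demicontractive ($\beta\in[0,1)$) if $Fix(S)\ne\emptyset$ and $\|S(x)-p\|^2\le\|x-p\|^2+\beta\|x-S(x)\|^2$ for all $p\in Fix(S)$, $x\in C$. It is demiclosed at zero if for each sequence $\{x_n\}\subset C$ converging weakly to $x$ with $\|S(x_n)-x_n\|\to0$ one has $S(x)=x$. $F:C\to H$ is $\eta$-strongly monotone if $\langle F(x)-F(y),x-y\rangle\ge\eta\|x-y\|^2$ and $L$-Lipschitz continuous if $\|F(x)-F(y)\|\le L\|x-y\|$, for all $x,y\in C$.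
   Formalization: It is additionally assumed that t_n lies in C for every n; otherwise S_j t_n is undefined, since S_j maps C to C and t_n = z_n − α_nF(z_n) can leave C (e.g. C=[1,2] in R, F(x)=x, x_0=1, f_i=0, S_j=id). *)

(* Defs.v *)
From HB Require Import structures.
From mathcomp Require Import all_boot all_order all_algebra sesquilinear.
From mathcomp Require Import all_classical all_reals all_analysis.
Import Order.TTheory GRing.Theory Num.Theory.
Import numFieldNormedType.Exports.

Set Implicit Arguments.
Unset Strict Implicit.
Unset Printing Implicit Defensive.

Local Open Scope classical_set_scope.
Local Open Scope ring_scope.

(* A real Hilbert space is a complete normed module
   H over R : realType together with an inner product ip whose norm is the
   norm of H, i.e. norm_from_ip ip.

   Mappings and bifunctions defined on a subset C of H are represented by
   functions on the whole of H; every condition below only constrains their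
   values on C. *)

Definition norm_from_ip (R : realType) (H : normedModType R)
    (ip : {dot H for @idfun R}) : Prop :=
  forall x : H, `|x| ^+ 2 = ip x x.

Definition weakly_cvg (R : realType) (H : normedModType R)
    (ip : {dot H for @idfun R}) (u : nat -> H) (x : H) : Prop :=
  forall h : H, ip (u n) h @[n --> \oo] --> ip x h.

Section bifunctions.
Variables (R : realType) (H : normedModType R) (ip : {dot H for @idfun R}).
Variables (C : set H) (f : H -> H -> R).

Definition EP : set H := [set x | C x /\ forall y, C y -> 0 <= f x y].

Definition pseudomonotone : Prop :=
  forall x y, C x -> C y -> 0 <= f x y -> f y x <= 0.

Definition lipschitz_type (c1 c2 : R) : Prop :=
  forall x y z, C x -> C y -> C z ->
    f x z - c1 * `|x - y| ^+ 2 - c2 * `|y - z| ^+ 2 <= f x y + f y z.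

(* The limit superior is taken in \bar R, as f (u n) y may be unbounded. *)
Definition weakly_usc_left : Prop :=
  forall (y : H) (u : nat -> H) (x : H), C y -> (forall n, C (u n)) -> C x ->
    weakly_cvg ip u x ->
    (limn_esup (fun n => (f (u n) y)%:E) <= (f x y)%:E)%E.

End bifunctions.

Section functionals.
Variables (R : realType) (H : normedModType R) (ip : {dot H for @idfun R}).
Variables (C : set H) (g : H -> R).

Definition subdifferentiable : Prop :=
  forall y, C y -> exists w : H, forall z, C z -> g y + ip w (z - y) <= g z.

Definition is_argmin (y : H) : Prop := C y /\ forall z, C z -> g y <= g z.

End functionals.

Section mappings.
Variables (R : realType) (H : normedModType R) (ip : {dot H for @idfun R}).
Variable C : set H.

Definition Fix (S : H -> H) : set H := [set x | C x /\ S x = x].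

Definition demicontractive (beta : R) (S : H -> H) : Prop :=
  Fix S !=set0 /\
  forall p x, Fix S p -> C x ->
    `|S x - p| ^+ 2 <= `|x - p| ^+ 2 + beta * `|x - S x| ^+ 2.

Definition demiclosed_at_zero (S : H -> H) : Prop :=
  forall (u : nat -> H) (x : H), (forall n, C (u n)) -> C x ->
    weakly_cvg ip u x -> `|S (u n) - u n| @[n --> \oo] --> (0 : R) -> S x = x.

Definition strongly_monotone (eta : R) (F : H -> H) : Prop :=
  forall x y, C x -> C y -> eta * `|x - y| ^+ 2 <= ip (F x - F y) (x - y).

Definition VI_solutions (F : H -> H) : set H :=
  [set x | C x /\ forall y, C y -> 0 <= ip (F x) (y - x)].

End mappings.

(* Main.v *)
Require Import Defs.
From HB Require Import structures.
From mathcomp Require Import all_boot all_order all_algebra sesquilinear.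
From mathcomp Require Import all_classical all_reals all_analysis.
From mathcomp Require Import ring lra.
Import Order.TTheory GRing.Theory Num.Theory.
Import numFieldNormedType.Exports.

Set Implicit Arguments.
Unset Strict Implicit.
Unset Printing Implicit Defensive.

Local Open Scope classical_set_scope.
Local Open Scope ring_scope.

(** Two facts drive the convergence.  First, weak compactness: a bounded sequence
    has a weak limit along an ultrafilter (Riesz), and a subsequence whose
    differences to that limit are almost orthogonal converges weakly to it.
    Second, with p the solution of the variational inequality and
    s n = |x n - p|^2, one iteration gives
      s (n+1) <= (1 - eta alpha_n) s n + 2 alpha_n <F p, p - t n> - gain n,
    where gain n >= 0 collects the residuals of the extragradient steps and of the
    demicontractive maps.  A weak cluster point of t along which the gain vanishes
    lies in Omega, so for each e > 0 there is mu > 0 such that, for n large,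
    either <F p, p - t n> <= e or gain n >= mu.  In the second case the gain absorbs
    the O(alpha_n) term; hence s (n+1) <= (1 - theta_n) s n + theta_n e' eventually,
    for every e' > 0, with theta_n = eta alpha_n of divergent sum, and s tends to 0. *)

(** * Inner product algebra and Cauchy-Schwarz *)

Section inner_product.
Variables (R : realType) (H : normedModType R) (ip : {dot H for @idfun R}).
Implicit Types (u v h : H) (k : R).

Lemma ipC u v : ip u v = ip v u.
Proof. by rewrite hermC expr0 mul1r. Qed.

Lemma ipDl u v h : ip (u + v) h = ip u h + ip v h.
Proof. exact: linearDl. Qed.

Lemma ipNl u h : ip (- u) h = - ip u h.
Proof. exact: linearNl. Qed.

Lemma ipZl k u h : ip (k *: u) h = k * ip u h.
Proof. exact: linearZl_LR. Qed.

Lemma ipDr h u v : ip h (u + v) = ip h u + ip h v.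
Proof. exact: linearDr. Qed.

Lemma ipNr h u : ip h (- u) = - ip h u.
Proof. exact: linearNr. Qed.

Lemma ipZr k h u : ip h (k *: u) = k * ip h u.
Proof. by rewrite ipC ipZl ipC. Qed.

Lemma ip0l h : ip 0 h = 0.
Proof. exact: linear0l. Qed.

Definition ipE := (ipDl, ipDr, ipNl, ipNr, ipZl, ipZr).

Hypothesis ip_norm : norm_from_ip ip.

Lemma ip_ge0 u : 0 <= ip u u.
Proof. by rewrite -ip_norm sqr_ge0. Qed.

Lemma ip_le_norm u v : ip u v <= `|u| * `|v|.
Proof.
have [->|u0] := eqVneq u 0; first by rewrite ip0l normr0 mul0r.
have [->|v0] := eqVneq v 0; first by rewrite ipC ip0l normr0 mulr0.
(* Expanding gives [2 |u| |v| (|u| |v| - ip u v) >= 0], whose prefactor is positive. *)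
have := ip_ge0 (`|v| *: u - `|u| *: v).
rewrite !ipE -!ip_norm (ipC v u) -!normr_gt0 in u0 v0 *.
have := mulr_gt0 u0 v0; set a := `|u| in u0 *; set c := `|v| in v0 *.
by move=> ac; nra.
Qed.

Lemma normr_ip_le u v : `|ip u v| <= `|u| * `|v|.
Proof. by rewrite ler_norml ip_le_norm lerNl -ipNl -(normrN u) ip_le_norm. Qed.

Lemma sqr_normD u v : `|u + v| ^+ 2 = `|u| ^+ 2 + 2 * ip u v + `|v| ^+ 2.
Proof. by rewrite !ip_norm !ipE (ipC v u); ring. Qed.

Lemma sqr_normB u v : `|u - v| ^+ 2 = `|u| ^+ 2 - 2 * ip u v + `|v| ^+ 2.
Proof. by rewrite !ip_norm !ipE (ipC v u); ring. Qed.

End inner_product.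

(** * Convexity with real weights; minimization over closed convex sets *)

Lemma convex_set_comb (R : realType) (H : normedModType R) (C : set H) x y (t : R) :
  convex_set C -> C x -> C y -> 0 <= t <= 1 -> C (t *: x + (1 - t) *: y).
Proof.
move=> C_convex Cx Cy /andP[t0 t1].
by have := C_convex x y (Itv01 t0 t1); rewrite !inE; exact.
Qed.

Lemma convex_set_of_comb (R : realType) (H : normedModType R) (C : set H) :
  (forall x y (t : R), C x -> C y -> 0 <= t <= 1 -> C (t *: x + (1 - t) *: y)) ->
  convex_set C.
Proof.
move=> C_comb x y t; rewrite !inE => Cx Cy.
by apply: C_comb => //; apply/andP; split.
Qed.

Lemma convex_function_comb (R : realType) (H : normedModType R) (C : set H)
    (g : H -> R) x y (t : R) :
  convex_function C g -> C x -> C y -> 0 <= t <= 1 ->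
  g (t *: x + (1 - t) *: y) <= t * g x + (1 - t) * g y.
Proof.
move=> g_convex Cx Cy /andP[t0 t1].
by have := g_convex (Itv01 t0 t1) x y; rewrite !inE; exact.
Qed.

(** Stands in for letting [t] tend to 0 in first-order optimality conditions: if [c] were positive,
    so would be [d], and [t = c / (2 (c + d))] would give [t d < c]. *)
Lemma ler_vanish_step (R : realType) (c d : R) :
  (forall t, 0 < t -> t <= 1 -> c <= t * d) -> c <= 0.
Proof.
move=> cd; rewrite leNgt; apply/negP => c0.
have d0 : 0 < d by have := cd 1 ltr01 (lexx _); rewrite mul1r; exact: lt_le_trans.
have t0 : 0 < c / (2 * (c + d)) by rewrite divr_gt0//; lra.
have := cd _ t0; rewrite ler_pdivrMr; last by lra.
rewrite mul1r => /(_ ltac:(lra)).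
by rewrite mulrAC ler_pdivlMr; [nra|lra].
Qed.

(* Minimize |u|^2 - 2 phi u over K.  K = setT gives the Riesz representation of
   phi, and phi = ip v the metric projection of v onto K. *)
Lemma closed_convex_variational (R : realType) (H : completeNormedModType R)
    (ip : {dot H for @idfun R}) (K : set H) (phi : H -> R) (B : R) :
  norm_from_ip ip -> closed K -> convex_set K -> K !=set0 -> scalar phi ->
  (forall u, `|phi u| <= B * `|u|) ->
  exists2 x, K x & forall y, K y -> phi (y - x) <= ip x (y - x).
Proof.
move=> ip_norm K_closed K_convex [k0 Kk0] phi_lin phi_bnd.
have phiD u v : phi (u + v) = phi u + phi v.
  by rewrite -[u in LHS]scale1r phi_lin mul1r.
have phi0 : phi 0 = 0 by have := phiD 0 0; rewrite addr0; lra.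
have phiZ a u : phi (a *: u) = a * phi u.
  by rewrite -[a *: u in LHS]addr0 phi_lin phi0 addr0.
have phiN u : phi (- u) = - phi u by rewrite -scaleN1r phiZ mulN1r.
pose g u := `|u| ^+ 2 - 2 * phi u.
have g_lb u : - B ^+ 2 <= g u.
  have := phi_bnd u; rewrite ler_norml /g => /andP[_].
  by have := sqr_ge0 (`|u| - B); rewrite sqrrB; lra.
pose E := g @` K; pose m := inf E.
have E_inf : has_inf E.
  split; first by exists (g k0), k0.
  by exists (- B ^+ 2) => _ [u Ku <-].
have m_le u : K u -> m <= g u.
  by move=> Ku; apply: ge_inf; [exact: E_inf.2|exists u].
have approx (n : nat) : exists u, K u /\ g u < m + n.+1%:R^-1.
  have [|_ [u Ku <-] gu] := @inf_adherent _ E n.+1%:R^-1 _ E_inf.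
    by rewrite invr_gt0.
  by exists u.
have [u uP] := choice approx.
(* The midpoint lies in [K], so its [g]-value is at least [m]; with the parallelogram law this makes
   minimizing sequences Cauchy. *)
have parallelogram (v v' : H) e : K v -> K v' -> g v <= m + e -> g v' <= m + e ->
    `|v - v'| ^+ 2 <= 4 * e.
  move=> Kv Kv' gv gv'.
  have := @convex_set_comb _ _ K v v' (2^-1) K_convex Kv Kv' ltac:(lra).
  move/m_le; rewrite /g (sqr_normD ip_norm) phiD !phiZ !normrZ.
  move: gv gv'; rewrite /g (sqr_normB ip_norm) !ipE.
  rewrite !ger0_norm; [|lra|lra].
  by rewrite !exprMn; lra.
have u_cauchy : cauchy (u @ \oo).
  apply: cauchy_exP => e e0.
  have e4 : 0 < e ^+ 2 / 4 by rewrite divr_gt0// exprn_gt0.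
  have [n _ nP] := near_infty_natSinv_lt (PosNum e4).
  exists (u n); exists n => // k /= nk.
  rewrite -ball_normE /= -(ltr_pXn2r (n := 2)) ?nnegrE ?(ltW e0)//.
  have [Kn gn] := uP n; have [Kk gk] := uP k.
  have /= nn := nP n (leqnn _).
  have gk' : g (u k) <= m + n.+1%:R^-1.
    by apply: (le_trans (ltW gk)); rewrite lerD2l lef_pV2 ?posrE// ler_nat ltnS.
  apply: le_lt_trans (parallelogram _ _ _ Kn Kk (ltW gn) gk') _.
  by move: nn; rewrite ltr_pdivlMr// mulrC.
have /cauchy_cvgP/cvg_ex[x ux] := u_cauchy.
have Kx : K x.
  apply: (@closed_cvg _ _ \oo _ u K K_closed _ x ux).
  by apply: nearW => n; exact: (uP n).1.
have x_min y : K y -> g x <= g y.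
  move=> Ky; apply: (le_trans _ (m_le _ Ky)).
  have g_cvg : g (u n) @[n --> \oo] --> g x.
    apply: cvgB.
      by rewrite expr2; under eq_fun do rewrite expr2; apply: cvgM; exact: cvg_norm.
    apply: cvgMr; apply/subr_cvg0/norm_cvg0P.
    have Bux : B * `|u n - x| @[n --> \oo] --> (0 : R).
      by rewrite -[0](mulr0 B); apply: cvgMr; apply/norm_cvg0P/subr_cvg0.
    apply: (squeeze_cvgr _ (cvg_cst 0) Bux).
    by apply: nearW => n; rewrite normr_ge0 -phiN -phiD phi_bnd.
  have m_cvg : m + n.+1%:R^-1 @[n --> \oo] --> m.
    by rewrite -[X in _ --> X]addr0; apply: cvgD; [exact: cvg_cst|exact: cvg_harmonic].
  apply: (ler_cvg_to g_cvg m_cvg).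
  by apply: nearW => n; exact/ltW/(uP n).2.
exists x => // y Ky; rewrite -subr_le0.
(* A step [t] from the minimizer [x] towards [y] changes [g] by [2 t (ip x (y - x) - phi (y - x)) +
   t^2 |y - x|^2 >= 0]; dividing by [2 t] leaves this error term. *)
apply: (@ler_vanish_step _ _ (`|y - x| ^+ 2 / 2)) => t t0 t1.
have := x_min _ (convex_set_comb K_convex Ky Kx (t := t) ltac:(lra)).
have -> : t *: y + (1 - t) *: x = x + t *: (y - x).
  by rewrite scalerBl scale1r scalerBr addrCA.
rewrite /g (sqr_normD ip_norm) phiD phiZ ipZr normrZ gtr0_norm// exprMn.
by move=> h; rewrite -(ler_pM2l t0); lra.
Qed.

(** * Weak sequential compactness of bounded sequences *)

Section weak_compactness.
Variables (R : realType) (H : completeNormedModType R).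
Variables (ip : {dot H for @idfun R}) (ip_norm : norm_from_ip ip).
Implicit Types (u : nat -> H) (x h : H).

(** Compactness of the segment gives a cluster point, and an ultrafilter converges to it because it
    contains each neighbourhood or its complement. *)
Lemma ultra_bounded_cvg (T : Type) (U : set_system T) (v : T -> R) (B : R) :
  UltraFilter U -> (forall n, `|v n| <= B) -> exists l : R, v n @[n --> U] --> l.
Proof.
move=> UU v_bnd.
have [|l [_ l_cluster]] := @segment_compact R (- B) B (v @ U) _.
  by apply: (@filterE _ U) => n /=; rewrite in_itv /= -ler_norml.
exists l => A lA; have [//|UnA] := in_ultra_setVsetC (v @^-1` A) UU.
by have [r []] := l_cluster (~` A) A UnA lA.
Qed.

(** Minimizing over the whole space, the test points [x + h] give [phi h <= ip x h]; the same bound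
    at [- h] gives equality. *)
Lemma riesz_representation (phi : H -> R) (B : R) : scalar phi ->
  (forall h, `|phi h| <= B * `|h|) -> exists x, forall h, phi h = ip x h.
Proof.
move=> phi_lin phi_bnd.
have [|||x _ xP] := closed_convex_variational ip_norm (K := setT) _ _ _ phi_lin phi_bnd.
- exact: closedT.
- by move=> *; rewrite inE.
- by exists 0.
have le_ip h : phi h <= ip x h by have := xP (x + h) I; rewrite addrC addKr.
have phi0 : phi 0 = 0.
  by have := phi_lin 1 0 0; rewrite scale1r addr0 mul1r; lra.
exists x => h; apply/eqP; rewrite eq_le le_ip /= -lerN2 -ipNr.
have := phi_lin (- 1) h 0; rewrite addr0 scaleN1r phi0 addr0 mulN1r => <-.
exact: le_ip.
Qed.

(** The ultralimits of [ip (u n) h] form a linear functional of [h] bounded by [B |h|], which Riesz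
    represents by a vector. *)
Lemma ultra_weak_limit u (B : R) (U : set_system nat) :
  UltraFilter U -> (forall n, `|u n| <= B) ->
  exists x, forall h, ip (u n) h @[n --> U] --> ip x h.
Proof.
move=> UU u_bnd.
have ip_bnd h n : `|ip (u n) h| <= B * `|h|.
  by apply: (le_trans (normr_ip_le ip_norm _ _)); rewrite ler_wpM2r.
have [phi phiP] := choice (fun h => ultra_bounded_cvg UU (ip_bnd h)).
have [k v v'|h|x xP] := @riesz_representation phi B.
- apply: (cvg_unique _ (phiP _)) => //=.
  under eq_fun do rewrite ipDr ipZr.
  by apply: cvgD (phiP _); apply: cvgMr (phiP _).
- have phi_norm : `|ip (u n) h| @[n --> U] --> `|phi h| by apply: cvg_norm.
  by apply: (cvgr_to_le phi_norm); apply: nearW.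
by exists x => h; rewrite -xP.
Qed.

(* Sums of m terms of a bounded, asymptotically orthogonal sequence have norm
   O(sqrt m), which no functional bounded away from 0 on those terms allows. *)
Lemma almost_orthogonal_weakly0 (e : nat -> H) (B : R) :
  (forall k, `|e k| <= B) ->
  (forall j k, (j < k)%N -> `|ip (e k) (e j)| <= k.+1%:R^-1) ->
  weakly_cvg ip e 0.
Proof.
move=> e_bnd e_orth.
suff half h eps : 0 < eps -> \forall k \near \oo, ip (e k) h < eps.
  move=> h; rewrite ip0l; apply/cvgr0Pnorm_lt => eps eps0.
  near=> k; rewrite ltr_norml ltrNl -ipNr; apply/andP; split; near: k; exact: half.
move=> eps0; apply: contrapT => not_near.
have frequent K : exists k, (K <= k)%N /\ eps <= ip (e k) h.
  apply: contrapT => nex; apply: not_near; exists K => // k /= Kk.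
  by rewrite ltNge; apply/negP => ek; apply: nex; exists k.
(* Adding one term costs at most [B ^+ 2] for its square and 2 for the cross term. *)
pose D := B ^+ 2 + 2.
have sums m : exists v K, [/\ m%:R * eps <= ip v h, `|v| ^+ 2 <= m%:R * D &
    forall k, (K <= k)%N -> `|ip (e k) v| <= m%:R / k.+1%:R].
  elim: m => [|m [v [K [vh vD vK]]]].
    exists 0, 0%N; split; rewrite ?mul0r ?ip0l ?normr0 ?expr0n//.
    by move=> k _; rewrite ipC ip0l normr0 mul0r.
  (* Beyond [K] the new term is almost orthogonal to [v]; beyond [m] the bound [m / (k + 1)] is at
     most 1. *)
  have [k [Kk ek]] := frequent (maxn K m).
  move: Kk; rewrite geq_max => /andP[Kk mk].
  exists (v + e k), k.+1; split.
  - by rewrite ipDl -natr1 mulrDl mul1r lerD.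
  - rewrite (sqr_normD ip_norm) -[m.+1%:R]natr1 [(m%:R + 1) * D]mulrDl mul1r -addrA lerD//.
    rewrite /D addrC lerD//; first by rewrite ler_sqr ?nnegrE// (le_trans _ (e_bnd k)).
    rewrite -[leRHS]mulr1 ler_wpM2l// ipC (le_trans (ler_norm _))//.
    rewrite (le_trans (vK k Kk))// ler_pdivrMr// mul1r ler_nat; exact: leqW.
  - move=> k' kk'; rewrite ipDr -[m.+1%:R]natr1 mulrDl mul1r (le_trans (ler_normD _ _))//.
    by rewrite lerD ?vK ?e_orth// (leq_trans Kk)// ltnW.
have D0 : 0 <= D by rewrite addr_ge0// sqr_ge0.
(* For this [m] Cauchy-Schwarz is contradicted: [(m eps)^2 <= |v|^2 |h|^2 <= m D |h|^2 < (m
   eps)^2]. *)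
pose m := (Num.trunc (D * `|h| ^+ 2 / eps ^+ 2)).+1.
have mP : D * `|h| ^+ 2 < m%:R * eps ^+ 2.
  by rewrite -ltr_pdivrMr ?exprn_gt0// truncnS_gt.
have [v [K [vh vD _]]] := sums m.
have m0 : 0 < m%:R :> R by rewrite ltr0n.
have : (m%:R * eps) ^+ 2 <= (`|v| * `|h|) ^+ 2.
  rewrite ler_sqr ?nnegrE ?mulr_ge0 ?(ltW eps0)//.
  exact: le_trans vh (ip_le_norm ip_norm _ _).
apply/negP; rewrite -ltNge !exprMn.
have := ler_wpM2r (sqr_ge0 `|h|) vD => /le_lt_trans; apply.
by rewrite expr2 -!mulrA ltr_pM2l.
Unshelve. all: by end_near. Qed.

Lemma bounded_weakly_cvg_subseq u (B : R) : (forall n, `|u n| <= B) ->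
  exists x (s : nat -> nat),
    (forall k, (k <= s k)%N) /\ weakly_cvg ip (u \o s) x.
Proof.
move=> u_bnd.
have [U [UU ooU]] := @ultraFilterLemma _ \oo _.
have [x xP] := ultra_weak_limit UU u_bnd.
pose e n := u n - x.
have e_bnd n : `|e n| <= B + `|x|.
  by rewrite (le_trans (ler_normB _ _))// lerD2r.
(* Since [ip (e n) (e j)] tends to 0 along [U], each of the finitely many conditions holds on a
   member of [U]; so does [size l <= n], as [U] refines [\oo]. *)
have ex_next (l : seq nat) : exists n, (size l <= n)%N /\
    forall j, j \in l -> `|ip (e n) (e j)| <= (size l).+1%:R^-1.
  have U_small (l' : seq nat) :
      U [set n | forall j, j \in l' -> `|ip (e n) (e j)| <= (size l).+1%:R^-1].
    elim: l' => [|i l' IH]; first exact: filterE.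
    have ei : \forall n \near U, `|ip (e n) (e i)| <= (size l).+1%:R^-1.
      apply: (cvgr0_norm_le (fun n => ip (e n) (e i))); last by rewrite invr_gt0.
      rewrite (_ : (fun n => _) = fun n => ip (u n) (e i) - ip x (e i)); last first.
        by apply/funext => n; rewrite ipDl ipNl.
      exact/subr_cvg0.
    apply: filterS2 ei IH => n ni nl j; rewrite inE => /orP[/eqP->//|]; exact: nl.
  have [|n [ln nl]] := @filter_ex _ U _ [set n | (size l <= n)%N /\
    forall j, j \in l -> `|ip (e n) (e j)| <= (size l).+1%:R^-1].
    apply: filterI (U_small l); apply: ooU; exact: nbhs_infty_ge.
  by exists n.
have [next nextP] := choice ex_next.
(* [L k] lists the first [k] chosen indices; its length bounds the next index from below and sets
   the tolerance [1 / (k + 1)]. *)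
pose L k := iter k (fun l => rcons l (next l)) [::].
have sizeL k : size (L k) = k by elim: k => //= k IH; rewrite size_rcons IH.
have memL j k : (j < k)%N -> next (L j) \in L k.
  elim: k => // k IH; rewrite ltnS leq_eqVlt /= mem_rcons inE.
  by move=> /orP[/eqP->|/IH->]; rewrite ?eqxx ?orbT.
exists x, (fun k => next (L k)); split.
  by move=> k; have [+ _] := nextP (L k); rewrite sizeL.
have e0 : weakly_cvg ip (fun k => e (next (L k))) 0.
  apply: (@almost_orthogonal_weakly0 _ (B + `|x|)) => // j k jk.
  by have [_ /(_ _ (memL _ _ jk))] := nextP (L k); rewrite sizeL.
move=> h; apply/subr_cvg0; have := e0 h; rewrite ip0l.
by under eq_fun do rewrite ipDl ipNl.
Qed.

(** With [p] the projection of [x] onto [K], the inequality [ip (x - p) (u n - p) <= 0] passes to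
    the weak limit and leaves [|x - p|^2 <= 0]. *)
Lemma closed_convex_weakly_closed (K : set H) u x : closed K -> convex_set K ->
  (forall n, K (u n)) -> weakly_cvg ip u x -> K x.
Proof.
move=> K_closed K_convex Ku ux.
have [||y|p Kp pP] := closed_convex_variational ip_norm K_closed K_convex (phi := ip x)
    (B := `|x|).
- by exists (u 0%N); exact: Ku.
- by move=> k v v'; rewrite ipDr ipZr.
- exact: normr_ip_le.
suff /eqP -> : x == p by [].
rewrite -subr_eq0 -normr_le0 -(ler_pXn2r (n := 2)) ?nnegrE// expr0n /=.
rewrite ip_norm; have up := ux (x - p).
have cst0 : ip x (x - p) - ip (u n) (x - p) @[n --> \oo] --> ip x (x - p) - ip x (x - p).
  by apply: cvgB up; exact: cvg_cst.
rewrite subrr in cst0.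
have : ip (x - p) (x - p) - 0 <= 0.
  apply: (cvgr_to_le (f := fun n => ip (x - p) (x - p) - (ip x (x - p) - ip (u n) (x - p))) (F := \oo)).
    by apply: cvgB cst0; exact: cvg_cst.
  apply: nearW => n; have := pP _ (Ku n); rewrite !ipE (ipC _ p x) (ipC _ (u n)) (ipC _ (u n)); lra.
by rewrite subr0.
Qed.

End weak_compactness.

(** * Sequential closedness, weak limits and the variational inequality *)

Lemma closed_of_seq (R : realType) (V : normedModType R) (A : set V) :
  (forall (u : nat -> V) x, (forall n, A (u n)) -> u n @[n --> \oo] --> x -> A x) ->
  closed A.
Proof.
move=> A_seq x x_clos.
have approx (n : nat) : exists v, A v /\ `|x - v| < n.+1%:R^-1.
  have [|v [Av xv]] := x_clos (ball x n.+1%:R^-1).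
    by apply: nbhsx_ballx; rewrite invr_gt0.
  by exists v; split => //; move: xv; rewrite -ball_normE.
have [u uP] := choice approx.
apply: (A_seq u) => [n|]; first exact: (uP n).1.
apply/cvgrPdist_lt => e e0.
have [n _ nP] := near_infty_natSinv_lt (PosNum e0).
by exists n => // k /nP; apply: lt_trans; exact: (uP k).2.
Qed.

Section hilbert.
Variables (R : realType) (H : completeNormedModType R).
Variables (ip : {dot H for @idfun R}) (ip_norm : norm_from_ip ip).
Implicit Types (u : nat -> H) (x h : H).

Lemma cvg_weakly_cvg u x : u n @[n --> \oo] --> x -> weakly_cvg ip u x.
Proof.
move=> ux h; apply/subr_cvg0/norm_cvg0P.
have bnd : `|u n - x| * `|h| @[n --> \oo] --> (0 : R).
  by rewrite -(mul0r `|h|); apply: cvgMl; apply/norm_cvg0P/subr_cvg0.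
apply: (squeeze_cvgr _ (cvg_cst 0) bnd); apply: nearW => n.
by rewrite normr_ge0 -ipNl -ipDl normr_ip_le.
Qed.

Lemma weakly_cvg_sub u v x :
  weakly_cvg ip u x -> (u n - v n) @[n --> \oo] --> 0 -> weakly_cvg ip v x.
Proof.
move=> ux uv h; rewrite -[ip x h]subr0 -(ip0l ip h).
rewrite [X in X @ _](_ : _ = fun n => ip (u n) h - ip (u n - v n) h); last first.
  by apply/funext => n; rewrite ipDl ipNl opprB addrC subrK.
by apply: cvgB (ux h) _; exact: cvg_weakly_cvg.
Qed.

(** A fixed point of [T x = P (x - mu F x)], with [P] the metric projection onto [K], is a solution.
    The choice [mu = eta / L^2] minimizes [1 - 2 mu eta + mu^2 L^2], with value [1 - mu eta < 1], so
    Banach's theorem applies to [T]. *)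
Lemma VI_solutions_neq0 (K : set H) (F : H -> H) (eta L : R) :
  closed K -> convex_set K -> K !=set0 -> 0 < eta -> 0 < L ->
  strongly_monotone ip K eta F -> L.-lipschitz_K F ->
  VI_solutions ip K F !=set0.
Proof.
move=> K_closed K_convex K0 eta0 L0 F_mono F_lip.
have ex_proj v : exists p, K p /\ forall y, K y -> ip v (y - p) <= ip p (y - p).
  have [||p Kp pP] := @closed_convex_variational _ _ _ K (ip v) `|v| ip_norm K_closed
    K_convex K0 _ _.
  - by move=> k w w'; rewrite ipDr ipZr.
  - exact: normr_ip_le.
  by exists p.
have [P PP] := choice ex_proj.
(* Add the two projection inequalities, each tested at the other projection, and apply
   Cauchy-Schwarz. *)
have P_nonexp v v' : `|P v - P v'| <= `|v - v'|.
  have [Kp pP] := PP v; have [Kp' pP'] := PP v'.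
  have := pP _ Kp'; have := pP' _ Kp; set p := P v; set p' := P v' => h1 h2.
  have : `|p - p'| ^+ 2 <= `|v - v'| * `|p - p'|.
    apply: le_trans (ip_le_norm ip_norm _ _).
    by move: h1 h2; rewrite ip_norm !ipE (ipC _ p' p); lra.
  rewrite expr2; have [->|pp'] := eqVneq p p'; first by rewrite subrr normr0.
  by rewrite ler_pM2r// normr_gt0 subr_eq0.
pose mu := eta / L ^+ 2.
have mu0 : 0 < mu by rewrite divr_gt0// exprn_gt0.
pose T x := P (x - mu *: F x).
have T_fun : {homo T : x / K x >-> K x} by move=> x _; exact: (PP _).1.
pose q := Num.sqrt (1 - mu * eta).
have q1 : q < 1 by rewrite -(sqrtr1 R) ltr_sqrt// ltrBlDr ltrDl mulr_gt0.
have q0 : 0 <= q by exact: sqrtr_ge0.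
have [|p Kp pT] := @banach_fixed_point _ _ _ (mkfun T_fun) _ K_closed K0.
  exists (NngNum q0); split => //= -[x y] [/= Kx Ky].
  rewrite (le_trans (P_nonexp _ _))// -(ler_pXn2r (n := 2)) ?nnegrE ?mulr_ge0//.
  rewrite exprMn.
  have -> : x - mu *: F x - (y - mu *: F y) = (x - y) - mu *: (F x - F y).
    by rewrite scalerBr !opprD addrACA.
  (* [Num.sqrt] is 0 on negative reals, and [mu * eta] may exceed 1 when [K] is a point; hence only
     an inequality. *)
  have qq : 1 - mu * eta <= q ^+ 2.
    have [c0|c0] := lerP 0 (1 - mu * eta); first by rewrite sqr_sqrtr.
    by rewrite (le_trans (ltW c0))// sqr_ge0.
  apply: le_trans (ler_wpM2r (sqr_ge0 _) qq).
  rewrite (sqr_normB ip_norm) ipZr normrZ (gtr0_norm mu0) exprMn (ipC _ (x - y)).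
  have mono := F_mono _ _ Kx Ky.
  have lip : `|F x - F y| ^+ 2 <= L ^+ 2 * `|x - y| ^+ 2.
    by rewrite -exprMn ler_pXn2r ?nnegrE ?mulr_ge0 ?(ltW L0)//; exact: (F_lip (x, y)).
  have muL : mu ^+ 2 * L ^+ 2 = mu * eta.
    by rewrite /mu; field; rewrite gt_eqF.
  have := ler_wpM2l (sqr_ge0 mu) lip; rewrite [leRHS]mulrA muL.
  have := ler_wpM2l (ltW mu0) mono; rewrite mulrA; lra.
exists p; split => // y Ky.
have := (PP (p - mu *: F p)).2 y Ky; rewrite -/(T p) -[T p]pT ipDl ipNl ipZl.
by rewrite gerDl oppr_le0 pmulr_rge0.
Qed.

(** The two inequalities, each tested at the other solution, add up to
    [ip (F x - F x') (x - x') <= 0]. *)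
Lemma VI_solutions_unique (K : set H) (F : H -> H) (eta : R) x x' :
  0 < eta -> strongly_monotone ip K eta F ->
  VI_solutions ip K F x -> VI_solutions ip K F x' -> x = x'.
Proof.
move=> eta0 F_mono [Kx xP] [Kx' xP'].
apply/eqP; rewrite -subr_eq0 -normr_le0 -(ler_pXn2r (n := 2)) ?nnegrE// expr0n /=.
have := F_mono _ _ Kx Kx'; have := xP _ Kx'; have := xP' _ Kx.
rewrite -(pmulr_rle0 _ eta0) !ipE; lra.
Qed.

End hilbert.

(** * Demicontractive maps and their fixed point sets *)

Section demicontractive_maps.
Variables (R : realType) (H : completeNormedModType R).
Variables (ip : {dot H for @idfun R}) (ip_norm : norm_from_ip ip).
Variables (C : set H) (beta : R) (S : H -> H).
Hypotheses (C_closed : closed C) (C_convex : convex_set C).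
Hypotheses (beta_lt1 : beta < 1) (S_demi : demicontractive C beta S).

(** Expand [|S x - p|^2] around [x - p]. The resulting form is affine in [p], from which convexity
    and closedness of [Fix C S] follow. *)
Lemma demicontractive_ip p x : Fix C S p -> C x ->
  (1 - beta) / 2 * `|x - S x| ^+ 2 <= ip (x - S x) (x - p).
Proof.
move=> Sp Cx; have := S_demi.2 _ _ Sp Cx.
have -> : S x - p = (x - p) - (x - S x) by rewrite opprB [RHS]addrC addrA subrK.
by rewrite (sqr_normB ip_norm (x - p)) (ipC ip (x - p)); lra.
Qed.

(** The cross term yields a decrease of [b (1 - beta) |x - S x|^2], of which the quadratic term
    [b^2 |x - S x|^2] consumes at most half. *)
Lemma demicontractive_relax p x b : Fix C S p -> C x ->
  0 <= b -> b <= (1 - beta) / 2 ->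
  `|(1 - b) *: x + b *: S x - p| ^+ 2 <=
    `|x - p| ^+ 2 - b * ((1 - beta) / 2) * `|x - S x| ^+ 2.
Proof.
move=> Sp Cx b0 bbeta.
have -> : (1 - b) *: x + b *: S x - p = (x - p) - b *: (x - S x).
  by rewrite scalerBl scale1r scalerBr opprB addrAC [x - _ - p]addrAC [RHS]addrA [RHS]addrAC.
rewrite (sqr_normB ip_norm (x - p)) normrZ exprMn (ger0_norm b0) ipZr (ipC ip (x - p)).
have := ler_wpM2l b0 (demicontractive_ip Sp Cx).
have : b * (b * `|x - S x| ^+ 2) <= b * ((1 - beta) / 2 * `|x - S x| ^+ 2).
  by rewrite ler_wpM2l// ler_wpM2r.
by lra.
Qed.

Lemma Fix_demicontractive p : C p ->
  (1 - beta) / 2 * `|p - S p| ^+ 2 <= 0 -> Fix C S p.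
Proof.
move=> Cp h; split => //; apply/esym/eqP.
rewrite -subr_eq0 -normr_le0 -(ler_pXn2r (n := 2)) ?nnegrE// expr0n /=.
by move: h; rewrite pmulr_rle0// divr_gt0// subr_gt0.
Qed.

(** At [q], the convex combination of the inner product bounds for [p] and [p'] has right-hand side
    [ip (q - S q) (q - q) = 0]. *)
Lemma Fix_convex : convex_set (Fix C S).
Proof.
apply: convex_set_of_comb => p p' t Sp Sp' t01; set q := _ + _.
have Cq : C q by apply: convex_set_comb; [|exact: Sp.1|exact: Sp'.1|].
apply: Fix_demicontractive => //.
have h1 := demicontractive_ip Sp Cq; have h2 := demicontractive_ip Sp' Cq.
move: t01 => /andP[t0 t1]; rewrite -subr_ge0 in t1.
have := ler_wpM2l t0 h1; have := ler_wpM2l t1 h2.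
have : t * ip (q - S q) (q - p) + (1 - t) * ip (q - S q) (q - p') = 0.
  rewrite -!ipZr -ipDr [X in ip _ X](_ : _ = 0) ?(ipC _ _ 0) ?ip0l//.
  rewrite !scalerBr addrACA -scalerDl -opprD -/q.
  by rewrite [_ + (1 - _)]addrC subrK scale1r subrr.
by lra.
Qed.

Lemma Fix_closed : closed (Fix C S).
Proof.
apply: closed_of_seq => u p Su up.
have Cp : C p.
  apply: (@closed_cvg _ _ \oo _ u C C_closed _ p up).
  by apply: nearW => n; exact: (Su n).1.
apply: Fix_demicontractive => //.
have := cvg_weakly_cvg ip_norm up; move/(_ (p - S p)) => upS.
have lim0 : ip (p - S p) p - ip (u n) (p - S p) @[n --> \oo]
    --> ip (p - S p) p - ip p (p - S p).
  by apply: cvgB upS; exact: cvg_cst.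
rewrite (ipC _ p) subrr in lim0; apply: (cvgr_to_ge lim0).
by apply: nearW => n; rewrite (ipC _ (u n)) -ipNr -ipDr demicontractive_ip.
Qed.

End demicontractive_maps.

(** * Equilibrium problems and the extragradient step *)

Section equilibrium.
Variables (R : realType) (H : completeNormedModType R).
Variables (ip : {dot H for @idfun R}) (ip_norm : norm_from_ip ip).
Variables (C : set H) (f : H -> H -> R).
Hypotheses (C_closed : closed C) (C_convex : convex_set C).
Hypotheses (f_mono : pseudomonotone C f) (f_diag : forall x, C x -> f x x = 0).
Hypothesis f_usc : weakly_usc_left ip C f.
Hypothesis f_convex : forall x, C x -> convex_function C (f x).

Lemma weakly_usc_left_ge (u : nat -> H) x y (e : nat -> R) l :
  C y -> (forall n, C (u n)) -> C x -> weakly_cvg ip u x ->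
  (forall n, e n <= f (u n) y) -> e n @[n --> \oo] --> l -> l <= f x y.
Proof.
move=> Cy Cu Cx ux ef el; rewrite -lee_fin.
apply: le_trans (f_usc Cy Cu Cx ux); rewrite limn_esup_lim.
apply: lime_ge; first exact: is_cvg_esups.
apply: nearW => n; apply/lee_subgt0Pr => d d0.
have : \forall k \near \oo, l - d <= e k by apply: (cvgr_ge _ el); rewrite gtrBl.
move=> /(filterI (nbhs_infty_ge n))/filter_ex[k [/= nk lk]].
apply: (@le_trans _ _ (f (u k) y)%:E).
  by rewrite -EFinB lee_fin (le_trans lk).
by apply: ereal_sup_ubound; exists k.
Qed.

Lemma EP_closed : closed (EP C f).
Proof.
apply: closed_of_seq => u p fu up.
have Cu n : C (u n) := (fu n).1.
have Cp : C p.
  by apply: (@closed_cvg _ _ \oo _ u C C_closed _ p up); apply: nearW.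
split=> // y Cy.
apply: (@weakly_usc_left_ge u p y (fun=> 0)) => //; last exact: cvg_cst.
- exact: cvg_weakly_cvg.
- by move=> n; exact: (fu n).2.
Qed.

(** Minty's argument: for [v] on the segment from [p] to [y], convexity and [f v v = 0] with
    [f v p <= 0] force [f v y >= 0]; then [v] tends to [p]. *)
Lemma EP_minty p : C p -> (forall y, C y -> f y p <= 0) -> EP C f p.
Proof.
move=> Cp fp; split=> // y Cy.
have step n : 0 <= (n.+1%:R^-1 : R) <= 1.
  by rewrite invr_ge0 ler0n invf_le1 ?ler1n.
pose v n := n.+1%:R^-1 *: y + (1 - n.+1%:R^-1) *: p.
have Cv n : C (v n) by apply: convex_set_comb.
apply: (@weakly_usc_left_ge v p y (fun=> 0)) => //; last exact: cvg_cst.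
- apply: cvg_weakly_cvg => //.
  have h : n.+1%:R^-1 *: (y - p) + p @[n --> \oo] --> (0 : R) *: (y - p) + p.
    by apply: cvgD; [apply: cvgZr_tmp; exact: cvg_harmonic|exact: cvg_cst].
  rewrite scale0r add0r in h.
  rewrite [X in X @ _](_ : _ = fun n => n.+1%:R^-1 *: (y - p) + p)//.
  by apply/funext => n; rewrite /v scalerBl scale1r scalerBr -addrA [p - _]addrC.
- move=> n; have := convex_function_comb (f_convex (Cv n)) Cy Cp (step n).
  rewrite -/(v n) f_diag// => h.
  have n0 : 0 < n.+1%:R^-1 :> R by rewrite invr_gt0.
  have : (1 - n.+1%:R^-1) * f (v n) p <= 0.
    by rewrite mulr_ge0_le0 ?fp// subr_ge0; case/andP: (step n).
  by rewrite -(pmulr_rge0 _ n0) => fvp; rewrite (le_trans h)// gerDl.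
Qed.

(** Pseudomonotonicity turns [f p y >= 0] into [f y p <= 0], a condition stable under convex
    combinations of [p], and Minty's argument converts back. *)
Lemma EP_convex : convex_set (EP C f).
Proof.
apply: convex_set_of_comb => p p' t fp fp' t01.
have [Cp fp0] := fp; have [Cp' fp'0] := fp'.
apply: EP_minty => [|y Cy]; first exact: convex_set_comb.
apply: (le_trans (convex_function_comb (f_convex Cy) Cp Cp' t01)).
case/andP: t01 => t0 t1.
rewrite -[leRHS]addr0 lerD// mulr_ge0_le0 ?subr_ge0 ?f_mono//; [exact: fp0|exact: fp'0].
Qed.

(** Optimality condition of the proximal step: compare [y] with [y + t (v - y)], bound [g] there by
    convexity, and let [t] vanish. *)
Lemma argmin_prox_variational (g : H -> R) (rho : R) x y v : convex_function C g ->
  is_argmin C (fun v => rho * g v + 1 / 2 * `|x - v| ^+ 2) y -> 0 <= rho -> C v ->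
  ip (x - y) (v - y) <= rho * (g v - g y).
Proof.
move=> g_convex [Cy y_min] rho0 Cv; rewrite -subr_le0.
apply: (@ler_vanish_step _ _ (`|v - y| ^+ 2 / 2)) => t t0 t1.
have t01 : 0 <= t <= 1 by rewrite ltW.
have := y_min _ (convex_set_comb C_convex Cv Cy t01).
have -> : t *: v + (1 - t) *: y = y + t *: (v - y).
  by rewrite scalerBl scale1r scalerBr addrCA.
have := ler_wpM2l rho0 (convex_function_comb g_convex Cv Cy t01).
have -> : t *: v + (1 - t) *: y = y + t *: (v - y).
  by rewrite scalerBl scale1r scalerBr addrCA.
have -> : x - (y + t *: (v - y)) = (x - y) - t *: (v - y) by rewrite opprD addrA.
rewrite (sqr_normB ip_norm (x - y)) ipZr normrZ gtr0_norm// exprMn.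
by move=> h1 h2; rewrite -(ler_pM2l t0); lra.
Qed.

Variables (c1 c2 rho : R) (rho_gt0 : 0 < rho).
Hypothesis f_lip : lipschitz_type C f c1 c2.
Variables (x y z : H) (Cx : C x).
Hypothesis y_min : is_argmin C (fun v => rho * f x v + 1 / 2 * `|x - v| ^+ 2) y.
Hypothesis z_min : is_argmin C (fun v => rho * f y v + 1 / 2 * `|x - v| ^+ 2) z.

(** Optimality of [y] tested at [z] bounds [f x z - f x y] from below; the Lipschitz-type condition
    trades that difference for [f y z]. *)
Lemma extragradient_ge :
  ip (x - y) (z - y) - rho * c1 * `|x - y| ^+ 2 - rho * c2 * `|y - z| ^+ 2
  <= rho * f y z.
Proof.
have [Cy _] := y_min; have [Cz _] := z_min.
have := argmin_prox_variational (f_convex Cx) y_min (ltW rho_gt0) Cz.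
by have := ler_wpM2l (ltW rho_gt0) (f_lip Cx Cy Cz); lra.
Qed.

(** Optimality of [z] tested at [p], where [f y p <= 0], combined with the lower bound on [f y z];
    polarization turns inner products into squares. *)
Lemma extragradient_step p : EP C f p ->
  `|z - p| ^+ 2 <= `|x - p| ^+ 2 - (1 - 2 * rho * c1) * `|x - y| ^+ 2
                   - (1 - 2 * rho * c2) * `|y - z| ^+ 2.
Proof.
move=> [Cp fp]; have [Cy _] := y_min.
have fyp : rho * f y p <= 0 by rewrite pmulr_rle0// f_mono// fp.
have := argmin_prox_variational (f_convex Cy) z_min (ltW rho_gt0) Cp.
have := extragradient_ge.
rewrite !ip_norm !ipE !(ipC ip y) !(ipC ip z) !(ipC ip p); lra.
Qed.

(** Serves for passing to the limit: the left-hand side vanishes with the residuals, so weak limits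
    of [y] satisfy the equilibrium inequality at [v]. *)
Lemma extragradient_ge_at v : C v ->
  ip (x - y) (z - y) - rho * c1 * `|x - y| ^+ 2 - rho * c2 * `|y - z| ^+ 2
    + ip (x - z) (v - z) <= rho * f y v.
Proof.
move=> Cv; have [Cy _] := y_min.
have := argmin_prox_variational (f_convex Cy) z_min (ltW rho_gt0) Cv.
by have := extragradient_ge; lra.
Qed.

End equilibrium.

(** * Convex combinations and convergence criteria for sequences *)

Lemma convex_set_sum (R : realType) (H : normedModType R) (C : set H) (I : finType)
    (w : I -> R) (v : I -> H) : convex_set C -> (forall i, 0 < w i) ->
  \sum_i w i = 1 -> (forall i, C (v i)) -> C (\sum_i w i *: v i).
Proof.
move=> C_convex w0 w1 Cv.
(* Induct over index lists on renormalized partial sums; positive weights keep the divisor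
   nonzero. *)
suff comb r : r != [::] ->
    0 < \sum_(i <- r) w i /\ C ((\sum_(i <- r) w i)^-1 *: \sum_(i <- r) w i *: v i).
  have [|_] := comb (index_enum I); last by rewrite w1 invr1 scale1r.
  by apply/eqP => r0; move: w1; rewrite r0 big_nil => /esym/eqP; rewrite oner_eq0.
elim: r => // i [_ _|j r IH _].
  by rewrite !big_seq1 scalerA mulVf ?gt_eqF// scale1r.
have [] := IH isT; rewrite !(big_cons _ _ i).
set W := \sum_(_ <- _) _; set V := \sum_(_ <- _) _ => W0 CV.
have wW : 0 < w i + W by rewrite addr_gt0.
split=> //; have := convex_set_comb (t := w i / (w i + W)) C_convex (Cv i) CV.
rewrite scalerA scalerDr scalerA [_^-1 * w i]mulrC.
have -> : (1 - w i / (w i + W)) * W^-1 = (w i + W)^-1.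
  by field; rewrite !gt_eqF.
apply; apply/andP; split; first by rewrite divr_ge0// ltW.
by rewrite ler_pdivrMr// mul1r lerDl ltW.
Qed.

Lemma ler_sum_term (R : numDomainType) (I : finType) (F : I -> R) i :
  (forall j, 0 <= F j) -> F i <= \sum_j F j.
Proof. by move=> F0; rewrite (bigD1 i)//= lerDl sumr_ge0. Qed.

Lemma sqr_norm_convex (R : realType) (H : normedModType R) (ip : {dot H for @idfun R})
    (I : finType) (w : I -> R) (v : I -> H) p :
  norm_from_ip ip -> (forall i, 0 <= w i) -> \sum_i w i = 1 ->
  `|\sum_i w i *: v i - p| ^+ 2 <= \sum_i w i * `|v i - p| ^+ 2.
Proof.
move=> ip_norm w0 w1; set m := \sum_i w i *: v i.
(* Tangent inequality for the squared norm at the mean [m]; in the weighted sum the linear terms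
   cancel. *)
have tangent i : w i * (`|m - p| ^+ 2 + 2 * ip (m - p) (v i - m)) <=
    w i * `|v i - p| ^+ 2.
  rewrite ler_wpM2l//.
  have -> : v i - p = (m - p) + (v i - m) by rewrite [RHS]addrC addrA subrK.
  by rewrite (sqr_normD ip_norm (m - p)) lerDl sqr_ge0.
apply: le_trans (ler_sum _ (fun i _ => tangent i)).
under eq_bigr => i _ do rewrite mulrDr [_ * (2 * _)]mulrCA -ipZr scalerBr.
rewrite big_split /= -mulr_suml w1 mul1r -mulr_sumr lerDl.
rewrite -(linear_sumr ip) sumrB -scaler_suml w1 scale1r -/m subrr.
by rewrite linear0r mulr0.
Qed.

Lemma cvg0_of_sqr_le (R : realType) (V : normedModType R) (d : nat -> V)
    (e : nat -> R) c : 0 < c ->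
  (\forall n \near \oo, c * `|d n| ^+ 2 <= e n) -> e n @[n --> \oo] --> 0 ->
  d n @[n --> \oo] --> 0.
Proof.
move=> c0 de e0; apply/cvgr0Pnorm_lt => r r0.
have cr : 0 < c * r ^+ 2 by rewrite mulr_gt0// exprn_gt0.
have := cvgr_lt _ e0 _ cr => er.
near=> n; rewrite -(ltr_pXn2r (n := 2)) ?nnegrE ?(ltW r0)// -(ltr_pM2l c0).
apply: (@le_lt_trans _ _ (e n)); near: n; [exact: de|exact: er].
Unshelve. all: by end_near. Qed.

(** Some tail infimum is positive; lying below a real value, it is a real [c]. *)
Lemma near_ge_of_limn_einf (R : realType) (u : nat -> R) :
  (0 < limn_einf (fun n => (u n)%:E))%E ->
  exists2 c, 0 < c & \forall n \near \oo, c <= u n.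
Proof.
rewrite limn_einf_lim => u_pos.
have [n un] : exists n, (0 < einfs (fun n => (u n)%:E) n)%E.
  apply: contrapT => nex; move: u_pos; apply/negP; rewrite -leNgt.
  apply: lime_le; first exact: is_cvg_einfs.
  by apply: nearW => n; rewrite leNgt; apply/negP => un; apply: nex; exists n.
have le_u k : (n <= k)%N -> (einfs (fun n => (u n)%:E) n <= (u k)%:E)%E.
  by move=> nk; apply: ereal_inf_lbound; exists k.
case: (einfs _ n) un le_u => [c c0 le_u|_ /(_ n (leqnn n))|] //.
by exists c => //; exists n => // k /= /le_u; rewrite lee_fin.
Qed.

(* Above the level e, each step lowers s by at least theta n * e / 2, which the
   divergence of the steps forbids forever; below it, s cannot go up again. *)
Lemma cvg0_of_descent (R : realType) (s theta : nat -> R) :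
  (forall n, 0 <= s n) -> (forall n, 0 <= theta n) ->
  (\forall n \near \oo, theta n <= 1) ->
  \sum_(1 <= k < n) theta k @[n --> \oo] --> +oo ->
  (forall e, 0 < e ->
    \forall n \near \oo, s n.+1 <= (1 - theta n) * s n + theta n * e) ->
  s n @[n --> \oo] --> 0.
Proof.
move=> s0 theta0 theta1 theta_sum descent; apply/cvgr0Pnorm_le => e e0.
have e2 : 0 < e / 2 by rewrite divr_gt0.
(* Level [e / 2] leaves a drop of [theta n * e / 2] whenever [s n > e]; [N >= 1] lets the sums
   starting at 1 be extended by their last term. *)
have [N _ NP] := filterI (nbhs_infty_ge 1) (filterI theta1 (descent _ e2)).
have stable n : (N <= n)%N -> s n <= e -> s n.+1 <= e.
  move=> /NP /= [_ [t1 sn]] se; apply: (le_trans sn).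
  have := theta0 n; rewrite -subr_ge0 in t1; nra.
have [n [Nn sn]] : exists n, (N <= n)%N /\ s n <= e.
  apply: contrapT => nex.
  have s_gt n : (N <= n)%N -> e < s n.
    by move=> Nn; rewrite ltNge; apply/negP => sn; apply: nex; exists n.
  pose A n := \sum_(1 <= k < n) theta k.
  have drop k : s (N + k)%N + e / 2 * A (N + k)%N <= s N + e / 2 * A N.
    elim: k => [|k IH]; first by rewrite addn0.
    apply: le_trans IH; rewrite addnS.
    have Nk := leq_addr k N; have [N1 [t1 sn]] := NP _ Nk.
    have := s_gt _ Nk; rewrite /A big_nat_recr//=.
    have := theta0 (N + k)%N; move: sn; nra.
  have [M _ MP] := (cvgryPgt _).1 theta_sum ((s N + e / 2 * A N) / (e / 2)).
  have := MP (N + M)%N (leq_addl _ _); rewrite ltr_pdivrMr// mulrC.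
  have := drop M; have := s0 (N + M)%N; rewrite -/(A (N + M)%N); lra.
exists n => // k /= /subnKC <-; rewrite ger0_norm//.
elim: (k - n)%N => [|l IH]; first by rewrite addn0.
by rewrite addnS stable// (leq_trans Nn)// leq_addr.
Qed.

Lemma ip_cvg0 (R : realType) (H : normedModType R) (ip : {dot H for @idfun R})
    (d v : nat -> H) (B : R) :
  norm_from_ip ip -> d n @[n --> \oo] --> 0 -> (\forall n \near \oo, `|v n| <= B) ->
  ip (d n) (v n) @[n --> \oo] --> 0.
Proof.
move=> ip_norm d0 vB; apply/norm_cvg0P.
have dB0 : `|d n| * B @[n --> \oo] --> (0 : R).
  by rewrite -(mul0r B); apply: cvgMl; apply/norm_cvg0P.
apply: squeeze_cvgr (cvg_cst 0) dB0; apply: filterS vB => n vB.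
by rewrite normr_ge0 (le_trans (normr_ip_le ip_norm _ _))// ler_wpM2l.
Qed.

Lemma sqr_norm_cvg0 (R : realType) (V : normedModType R) (d : nat -> V) (c : R) :
  d n @[n --> \oo] --> 0 -> c * `|d n| ^+ 2 @[n --> \oo] --> 0.
Proof.
move=> /norm_cvg0P d0; rewrite -[0](mulr0 c); apply: cvgMr.
by rewrite -[0](mulr0 0); under eq_fun do rewrite expr2; exact: cvgM.
Qed.

Lemma subr_cvg0_trans (R : realType) (V : normedModType R) (u v h : nat -> V) :
  u n - v n @[n --> \oo] --> 0 -> v n - h n @[n --> \oo] --> 0 ->
  u n - h n @[n --> \oo] --> 0.
Proof.
move=> uv vh; rewrite -[X in _ --> X](addr0 0).
rewrite [X in X @ _](_ : _ = fun n => (u n - v n) + (v n - h n)); first exact: cvgD.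
by apply/funext => n; rewrite addrA subrK.
Qed.

(** * The iteration: one-step estimates, boundedness, weak cluster points, convergence *)

Section iteration.
Variables (R : realType) (H : completeNormedModType R).
Variables (ip : {dot H for @idfun R}) (ip_norm : norm_from_ip ip).
Variables (C : set H) (C_closed : closed C) (C_convex : convex_set C).
Variables (N M : nat) (f : 'I_N -> H -> H -> R) (c1 c2 : R).
Hypothesis c1_gt0 : 0 < c1.
Hypothesis c2_gt0 : 0 < c2.
Hypothesis f_mono : forall i, pseudomonotone C (f i).
Hypothesis f_lip : forall i, lipschitz_type C (f i) c1 c2.
Hypothesis f_usc : forall i, weakly_usc_left ip C (f i).
Hypothesis f_convex : forall i x, C x -> convex_function C (f i x).
Variables (S : 'I_M -> H -> H) (beta : R).
Hypothesis beta_lt1 : beta < 1.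
Hypothesis beta_ge0 : 0 <= beta.
Hypothesis S_maps : forall j, set_fun C C (S j).
Hypothesis S_demi : forall j, demicontractive C beta (S j).
Hypothesis S_closed : forall j, demiclosed_at_zero ip C (S j).
Variables (F : H -> H) (eta L : R) (eta_gt0 : 0 < eta) (L_gt0 : 0 < L).
Hypothesis F_mono : strongly_monotone ip C eta F.
Hypothesis F_lip : L.-lipschitz_C F.
Variables (rho : R) (rho_gt0 : 0 < rho).
Hypothesis rho_lt : rho < Num.min (1 / (2 * c1)) (1 / (2 * c2)).
Variables (alpha : nat -> R) (alpha_gt0 : forall n, 0 < alpha n).
Hypothesis alpha_cvg : alpha n @[n --> \oo] --> 0.
Hypothesis alpha_sum : \sum_(1 <= k < n) alpha k @[n --> \oo] --> +oo.
Variables (b : nat -> 'I_M -> R) (a : R) (a_gt0 : 0 < a).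
Hypothesis b_bounds : forall n j, a <= b n j /\ b n j < (1 - beta) / 2.
Variables (w : nat -> 'I_N -> R) (gamma : nat -> 'I_M -> R).
Hypothesis w_gt0 : forall n i, 0 < w n i.
Hypothesis w_sum : forall n, \sum_i w n i = 1.
Hypothesis w_liminf : forall i, (0 < limn_einf (fun n => (w n i)%:E))%E.
Hypothesis gamma_gt0 : forall n j, 0 < gamma n j.
Hypothesis gamma_sum : forall n, \sum_j gamma n j = 1.
Hypothesis gamma_liminf : forall j, (0 < limn_einf (fun n => (gamma n j)%:E))%E.
Variables (x : nat -> H) (y z : nat -> 'I_N -> H) (zb t : nat -> H).
Hypothesis x0_in : C (x 0%N).
Hypothesis y_def : forall n i,
  is_argmin C (fun v => rho * f i (x n) v + 1 / 2 * `|x n - v| ^+ 2) (y n i).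
Hypothesis z_def : forall n i,
  is_argmin C (fun v => rho * f i (y n i) v + 1 / 2 * `|x n - v| ^+ 2) (z n i).
Hypothesis zb_def : forall n, zb n = \sum_i w n i *: z n i.
Hypothesis t_def : forall n, t n = zb n - alpha n *: F (zb n).
Hypothesis t_in : forall n, C (t n).
Hypothesis x_def : forall n, x n.+1 =
  \sum_j gamma n j *: ((1 - b n j) *: t n + b n j *: S j (t n)).

Let Omega : set H :=
  (\bigcap_(i in setT) EP C (f i)) `&` (\bigcap_(j in setT) Fix C (S j)).

Let k1 := 1 - 2 * rho * c1.
Let k2 := 1 - 2 * rho * c2.
Let kappa := a * ((1 - beta) / 2).

(** The extragradient residuals are halved because the step along [F] multiplies them by
    [1 - alpha n * eta], eventually at least [1 / 2]. *)
Let gain n := (\sum_i w n i * (k1 * `|x n - y n i| ^+ 2 + k2 * `|y n i - z n i| ^+ 2)) / 2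
  + kappa * \sum_j gamma n j * `|t n - S j (t n)| ^+ 2.

Lemma k1_gt0 : 0 < k1.
Proof.
move: rho_lt; rewrite lt_min => /andP[+ _].
by rewrite ltr_pdivlMr ?mulr_gt0// /k1; lra.
Qed.

Lemma k2_gt0 : 0 < k2.
Proof.
move: rho_lt; rewrite lt_min => /andP[_].
by rewrite ltr_pdivlMr ?mulr_gt0// /k2; lra.
Qed.

Lemma kappa_gt0 : 0 < kappa.
Proof. by rewrite mulr_gt0// divr_gt0// subr_gt0. Qed.

Lemma yC n i : C (y n i). Proof. exact: (y_def n i).1. Qed.

Lemma zC n i : C (z n i). Proof. exact: (z_def n i).1. Qed.

Lemma zbC n : C (zb n).
Proof. by rewrite zb_def; apply: convex_set_sum => // i; exact: zC. Qed.

Lemma xC n : C (x n).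
Proof.
case: n => // n; rewrite x_def; apply: convex_set_sum => // j.
have [ab bb] := b_bounds n j; rewrite addrC.
have := convex_set_comb (t := b n j) C_convex (S_maps j (t_in n)) (t_in n).
by apply; move: beta_ge0 a_gt0 => ? ?; apply/andP; split; lra.
Qed.

Lemma zb_step n p : (forall i, EP C (f i) p) ->
  `|zb n - p| ^+ 2 <= `|x n - p| ^+ 2
    - \sum_i w n i * (k1 * `|x n - y n i| ^+ 2 + k2 * `|y n i - z n i| ^+ 2).
Proof.
move=> fp; rewrite zb_def.
apply: (le_trans (sqr_norm_convex _ _ ip_norm _ (w_sum n))) => [i|]; first exact: ltW.
rewrite -[X in X - _]mul1r -(w_sum n) mulr_suml -sumrB; apply: ler_sum => i _.
rewrite -mulrBr ler_wpM2l ?(ltW (w_gt0 _ _))//.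
have := extragradient_step ip_norm C_convex (@f_mono i) (@f_convex i) rho_gt0
  (f_lip i) (xC n) (y_def n i) (z_def n i) (fp i).
by rewrite /k1 /k2; lra.
Qed.

Lemma x_step n p : (forall j, Fix C (S j) p) ->
  `|x n.+1 - p| ^+ 2 <= `|t n - p| ^+ 2
    - kappa * \sum_j gamma n j * `|t n - S j (t n)| ^+ 2.
Proof.
move=> Sp; rewrite x_def.
apply: (le_trans (sqr_norm_convex _ _ ip_norm _ (gamma_sum n))) => [j|]; first exact: ltW.
rewrite -[X in X - _]mul1r -[X in _ <= X * _ - _](gamma_sum n) mulr_suml mulr_sumr -sumrB.
apply: ler_sum => j _; rewrite [kappa * _]mulrCA -mulrBr ler_wpM2l ?(ltW (gamma_gt0 _ _))//.
have [ab bb] := b_bounds n j; move: a_gt0 beta_lt1 => ? ?.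
have b0 : 0 <= b n j by lra.
apply: le_trans (demicontractive_relax ip_norm (S_demi j) (Sp j) (t_in n) b0 (ltW bb)) _.
by rewrite lerD2l lerN2 ler_wpM2r ?sqr_ge0// ler_wpM2r// divr_ge0//; lra.
Qed.

(** Write [t n - p] as [d - alpha e - alpha F p], with [d = zb n - p] and [e = F (zb n) - F p].
    Monotonicity and the bound on [alpha n] give [|d - alpha e|^2 <= (1 - alpha eta) |d|^2]; the
    part [alpha F p] yields the last term. *)
Lemma t_step n p : C p -> alpha n <= eta / L ^+ 2 ->
  `|t n - p| ^+ 2 <= (1 - alpha n * eta) * `|zb n - p| ^+ 2
    + 2 * alpha n * ip (F p) (p - t n).
Proof.
move=> Cp al; have Cz := zbC n; have a0 := alpha_gt0 n.
have mono := ler_wpM2l (ltW a0) (F_mono Cz Cp).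
have lip : `|F (zb n) - F p| ^+ 2 <= L ^+ 2 * `|zb n - p| ^+ 2.
  by rewrite -exprMn ler_pXn2r ?nnegrE ?mulr_ge0 ?(ltW L_gt0)//; exact: (@F_lip (zb n, p)).
have aL : alpha n ^+ 2 * L ^+ 2 <= alpha n * eta.
  by rewrite expr2 -mulrA ler_wpM2l ?(ltW a0)// -ler_pdivlMr ?exprn_gt0.
have := ler_wpM2l (sqr_ge0 (alpha n)) lip; rewrite [leRHS]mulrA => alip.
have := le_trans alip (ler_wpM2r (sqr_ge0 _) aL) => {}alip.
set d := zb n - p in mono alip *; set e := F (zb n) - F p in mono alip *.
have tE : t n - p = (d - alpha n *: e) - alpha n *: F p.
  by rewrite t_def /d /e scalerBr opprB addrA addrAC addrK addrAC.
have : `|t n - p| ^+ 2 <= `|d - alpha n *: e| ^+ 2 + 2 * alpha n * ip (F p) (p - t n).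
  have -> : ip (F p) (p - t n) = - ip (t n - p) (F p) by rewrite ipC -ipNl opprB.
  have := sqr_ge0 `|alpha n *: F p|.
  have -> : `|d - alpha n *: e| ^+ 2 = `|(t n - p) + alpha n *: F p| ^+ 2.
    by rewrite tE subrK.
  by rewrite (sqr_normD ip_norm (t n - p)) ipZr; lra.
move=> /le_trans; apply; rewrite lerD2r (sqr_normB ip_norm d) ipZr normrZ exprMn.
by rewrite (gtr0_norm a0) (ipC ip d); lra.
Qed.

Lemma gain_terms_ge0 n :
  (forall i, 0 <= w n i * (k1 * `|x n - y n i| ^+ 2 + k2 * `|y n i - z n i| ^+ 2)) /\
  (forall j, 0 <= gamma n j * `|t n - S j (t n)| ^+ 2).
Proof.
split=> k; rewrite mulr_ge0 ?sqr_ge0 ?(ltW (w_gt0 _ _)) ?(ltW (gamma_gt0 _ _))//.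
by rewrite addr_ge0// mulr_ge0 ?sqr_ge0// ltW ?k1_gt0 ?k2_gt0.
Qed.

Lemma gain_sums_ge0 n :
  0 <= \sum_i w n i * (k1 * `|x n - y n i| ^+ 2 + k2 * `|y n i - z n i| ^+ 2) /\
  0 <= kappa * \sum_j gamma n j * `|t n - S j (t n)| ^+ 2.
Proof.
have [g1 g2] := gain_terms_ge0 n; split; last apply: mulr_ge0.
- by apply: sumr_ge0 => i _; exact: g1.
- exact/ltW/kappa_gt0.
- by apply: sumr_ge0 => j _; exact: g2.
Qed.

Lemma gain_ge0 n : 0 <= gain n.
Proof. by have [g1 g2] := gain_sums_ge0 n; rewrite addr_ge0// divr_ge0. Qed.

Lemma gain_ge_extragradient n i :
  w n i * (k1 * `|x n - y n i| ^+ 2 + k2 * `|y n i - z n i| ^+ 2) <= 2 * gain n.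
Proof.
apply: (le_trans (ler_sum_term i (gain_terms_ge0 n).1)).
rewrite mulrDr mulrCA mulfV// mulr1 lerDl mulr_ge0//.
exact: (gain_sums_ge0 n).2.
Qed.

Lemma gain_ge_Fix n j :
  kappa * (gamma n j * `|t n - S j (t n)| ^+ 2) <= gain n.
Proof.
rewrite -[leLHS]add0r lerD//; first by rewrite divr_ge0// (gain_sums_ge0 n).1.
by rewrite ler_wpM2l ?(ltW kappa_gt0)// (ler_sum_term j (gain_terms_ge0 n).2).
Qed.

Lemma alpha_small c : 0 < c -> \forall n \near \oo, alpha n <= c.
Proof. by move=> c0; exact: (cvgr_le _ alpha_cvg). Qed.

Lemma Omega_sub : Omega `<=` C.
Proof.
(* An empty intersection would be the whole space; weights summing to 1 exclude an empty index
   set. *)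
move=> p [fp _]; have [i _|N0] := pickP 'I_N; first exact: (fp i I).1.
have := w_sum 0; rewrite big_pred0; last by move=> i; have := N0 i.
by move/eqP; rewrite eq_sym oner_eq0.
Qed.

Lemma main_step p : Omega p -> \forall n \near \oo,
  [/\ `|zb n - p| ^+ 2 <= `|x n - p| ^+ 2,
      `|t n - p| ^+ 2 <= (1 - alpha n * eta) * `|x n - p| ^+ 2
        + 2 * alpha n * ip (F p) (p - t n),
      `|x n.+1 - p| ^+ 2 <= `|t n - p| ^+ 2 &
      `|x n.+1 - p| ^+ 2 <= (1 - alpha n * eta) * `|x n - p| ^+ 2
        + 2 * alpha n * ip (F p) (p - t n) - gain n].
Proof.
move=> [fp Sp].
have al1 := alpha_small (divr_gt0 eta_gt0 (exprn_gt0 2 L_gt0)).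
have al2 : \forall n \near \oo, alpha n <= (2 * eta)^-1.
  by apply: alpha_small; rewrite invr_gt0 mulr_gt0.
apply: filterS2 al1 al2 => n al1 al2.
have aeta : alpha n * eta <= 1 / 2.
  by rewrite -ler_pdivlMr// (le_trans al2)// invfM mul1r.
have zs := zb_step n (fun i => fp i I); have xs := x_step n (fun j => Sp j I).
move: (gain_sums_ge0 n) zs xs; rewrite /gain.
set Gz := \sum_i _; set Gt := kappa * _ => -[Gz0 Gt0] zs xs.
have Cp := Omega_sub (conj fp Sp).
have ts := t_step Cp al1.
have ae0 : 0 <= 1 - alpha n * eta by lra.
have := ler_wpM2l ae0 zs.
have : 1 / 2 * Gz <= (1 - alpha n * eta) * Gz by rewrite ler_wpM2r//; lra.
by move=> h1 h2; split; lra.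
Qed.

(** The ball of squared radius [Q] around [p] is eventually invariant: by Young's inequality and
    [4 A^2 <= eta^2 Q], the term with [F p] costs at most [alpha eta / 2 (T^2 + Q)], which the
    contraction factor compensates. *)
Lemma iterates_bounded p : Omega p -> exists K, \forall n \near \oo,
  [/\ `|x n - p| <= K, `|zb n - p| <= K & `|t n - p| <= K].
Proof.
move=> Op; pose A := `|F p|.
have al : \forall n \near \oo, alpha n <= eta^-1 by apply: alpha_small; rewrite invr_gt0.
have [N0 _ NP] := filterI (main_step Op) al.
pose Q := Num.max (`|x N0 - p| ^+ 2) (4 * A ^+ 2 / eta ^+ 2).
have AQ : 4 * A ^+ 2 <= eta ^+ 2 * Q.
  by rewrite -ler_pdivrMl ?exprn_gt0// [_^-1 * _]mulrC /Q le_max lexx orbT.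
have t_le n : (N0 <= n)%N -> `|x n - p| ^+ 2 <= Q -> `|t n - p| ^+ 2 <= Q.
  move=> /NP[/= [_ tn _ _] an] xQ.
  have a0 := alpha_gt0 n; have e0 := eta_gt0; have {an} an : alpha n * eta <= 1.
    by rewrite -ler_pdivlMr// mul1r.
  have := ip_le_norm ip_norm (F p) (p - t n); rewrite -/A [`|p - t n|]distrC.
  move: (normr_ge0 (t n - p)) tn; set T := `|t n - p|; set u := ip _ _ => T0 tn uAT.
  have young : 2 * (A * T) <= eta / 2 * (T ^+ 2 + Q).
    rewrite -(ler_pM2l e0).
    by have := sqr_ge0 (eta * T - 2 * A); move: AQ; rewrite !expr2; lra.
  have aut : alpha n * (2 * u) <= alpha n * (eta / 2 * (T ^+ 2 + Q)).
    by rewrite ler_wpM2l ?(ltW a0)//; lra.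
  have xQ' : (1 - alpha n * eta) * `|x n - p| ^+ 2 <= (1 - alpha n * eta) * Q.
    by rewrite ler_wpM2l// subr_ge0.
  rewrite leNgt; apply/negP => QT.
  have : 0 < (1 - alpha n * eta / 2) * (T ^+ 2 - Q) by rewrite mulr_gt0//; lra.
  by lra.
have x_le n : (N0 <= n)%N -> `|x n - p| ^+ 2 <= Q.
  move=> /subnKC <-; elim: (n - N0)%N => [|k IH]; first by rewrite addn0 /Q le_max lexx.
  have Nk := leq_addr k N0; have [[_ _ xt _] _] := NP _ Nk.
  by rewrite addnS (le_trans xt)// t_le.
(* [|v| <= |v|^2 + 1] replaces a square root of [Q]. *)
have le_Q (v : H) : `|v| ^+ 2 <= Q -> `|v| <= Q + 1.
  by have := sqr_ge0 (`|v| - 1); rewrite sqrrB; have := normr_ge0 v; lra.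
exists (Q + 1), N0 => // n /= Nn; have [[zx _ _ _] _] := NP _ Nn.
by split; apply: le_Q; [exact: x_le|exact: le_trans zx (x_le _ Nn)|exact: t_le (x_le _ Nn)].
Qed.

(** Of the divisor 4, one factor 2 comes from [|u + v|^2 <= 2 |u|^2 + 2 |v|^2], the other from the
    halving in [gain]. *)
Lemma gain_ge_zb n : Num.min k1 k2 / 4 * `|zb n - x n| ^+ 2 <= gain n.
Proof.
set k := Num.min k1 k2.
have k0 : 0 < k by rewrite lt_min k1_gt0 k2_gt0.
have kk1 : k <= k1 by rewrite ge_min lexx.
have kk2 : k <= k2 by rewrite ge_min lexx orbT.
have [_ g2] := gain_sums_ge0 n.
have -> : k / 4 * `|zb n - x n| ^+ 2 = (k / 2 * `|zb n - x n| ^+ 2) / 2 by field.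
rewrite /gain -[leLHS]addr0 lerD// ler_wpM2r// zb_def.
have k2_ge0 : 0 <= k / 2 by rewrite divr_ge0// ltW.
have w0 i := ltW (w_gt0 n i).
apply: (le_trans (ler_wpM2l k2_ge0 (sqr_norm_convex _ _ ip_norm w0 (w_sum n)))).
rewrite mulr_sumr; apply: ler_sum => i _; rewrite mulrCA ler_wpM2l//.
have -> : z n i - x n = - ((x n - y n i) + (y n i - z n i)).
  by rewrite addrA subrK opprB.
rewrite normrN; set u := x n - y n i; set v := y n i - z n i.
have : `|u + v| ^+ 2 <= 2 * `|u| ^+ 2 + 2 * `|v| ^+ 2.
  by have := sqr_ge0 `|u - v|; rewrite (sqr_normB ip_norm u v) (sqr_normD ip_norm u v); lra.
move=> /(ler_wpM2l k2_ge0) /le_trans; apply.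
have := ler_wpM2r (sqr_ge0 `|u|) kk1; have := ler_wpM2r (sqr_ge0 `|v|) kk2; lra.
Qed.

(** Vanishing gain makes [t], [zb], [x] and every [y i] asymptotically equal along [m], so [q] is
    their common weak limit; demiclosedness handles the fixed points, weak upper semicontinuity the
    equilibria. *)
Lemma weak_cluster_Omega p (m : nat -> nat) q : Omega p ->
  (forall k, (k <= m k)%N) -> gain (m k) @[k --> \oo] --> 0 ->
  weakly_cvg ip (t \o m) q -> Omega q.
Proof.
move=> Op m_ge gain0 tq.
have sub (P : set nat) : (\forall n \near \oo, P n) -> \forall k \near \oo, P (m k).
  by move=> [N0 _ NP]; exists N0 => // k /= Nk; apply: NP; exact: leq_trans (m_ge k).
have gain20 : 2 * gain (m k) @[k --> \oo] --> 0.
  by rewrite -[0](mulr0 2); apply: cvgMr.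
have Cq : C q by apply: closed_convex_weakly_closed tq => // n; exact: t_in.
have [K KP] := iterates_bounded Op.
have zbx : zb (m k) - x (m k) @[k --> \oo] --> 0.
  apply: (cvg0_of_sqr_le _ _ gain0); last by apply: nearW => k; exact: gain_ge_zb.
  by rewrite divr_gt0// lt_min k1_gt0 k2_gt0.
have tzb : t (m k) - zb (m k) @[k --> \oo] --> 0.
  have alpha0 : alpha (m k) @[k --> \oo] --> 0.
    apply/cvgrPdist_le => e e0; apply: (sub (fun n => `|0 - alpha n| <= e)).
    by have /cvgrPdist_le/(_ _ e0) := alpha_cvg.
  (* [|F p| + L * K] bounds [F (zb n)] by the Lipschitz condition. *)
  have bnd0 : alpha (m k) * (`|F p| + L * K) @[k --> \oo] --> 0.
    by rewrite -(mul0r (`|F p| + L * K)); apply: cvgMl.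
  apply/norm_cvg0P; apply: squeeze_cvgr (cvg_cst 0) bnd0.
  apply: filterS (sub _ KP) => k [_ zK _].
  have a0 := alpha_gt0 (m k).
  rewrite normr_ge0 t_def addrC addKr normrN normrZ gtr0_norm// ler_wpM2l ?(ltW a0)//.
  rewrite -(subrK (F p) (F (zb _))) addrC (le_trans (ler_normD _ _))// lerD2l.
  apply: (@le_trans _ _ (L * `|zb (m k) - p|)); last by rewrite ler_wpM2l// ltW.
  by apply: (@F_lip (_, _)); split; [exact: zbC|exact: Omega_sub].
have tx : t (m k) - x (m k) @[k --> \oo] --> 0.
  exact: subr_cvg0_trans tzb zbx.
have xq : weakly_cvg ip (x \o m) q.
  exact: (@weakly_cvg_sub _ _ _ ip_norm (t \o m) (x \o m) q tq tx).
split=> [i _|j _].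
- have [c c0 cw] := near_ge_of_limn_einf (w_liminf i).
  have terms k : c <= w (m k) i ->
      c * k1 * `|x (m k) - y (m k) i| ^+ 2 <= 2 * gain (m k) /\
      c * k2 * `|y (m k) i - z (m k) i| ^+ 2 <= 2 * gain (m k).
    move=> ckw; have k1_0 := ltW k1_gt0; have k2_0 := ltW k2_gt0.
    split; apply: le_trans (gain_ge_extragradient (m k) i); rewrite -mulrA ler_pM//;
      rewrite ?(ltW c0) ?mulr_ge0//; [rewrite lerDl|rewrite lerDr];
      by rewrite mulr_ge0.
  have xy : x (m k) - y (m k) i @[k --> \oo] --> 0.
    apply: (cvg0_of_sqr_le _ _ gain20); first exact: mulr_gt0 c0 k1_gt0.
    by apply: filterS (sub _ cw) => k /terms[].
  have yz : y (m k) i - z (m k) i @[k --> \oo] --> 0.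
    apply: (cvg0_of_sqr_le _ _ gain20); first exact: mulr_gt0 c0 k2_gt0.
    by apply: filterS (sub _ cw) => k /terms[].
  have xz : x (m k) - z (m k) i @[k --> \oo] --> 0.
    exact: subr_cvg0_trans xy yz.
  have yq : weakly_cvg ip (fun k => y (m k) i) q.
    exact: (@weakly_cvg_sub _ _ _ ip_norm (x \o m) (fun k => y (m k) i) q xq xy).
  split=> // v Cv.
  (* [e k] is the lower bound of [extragradient_ge_at] for [rho * f i (y (m k) i) v]; all its terms
     tend to 0. *)
  pose e k := ip (x (m k) - y (m k) i) (z (m k) i - y (m k) i)
    - rho * c1 * `|x (m k) - y (m k) i| ^+ 2 - rho * c2 * `|y (m k) i - z (m k) i| ^+ 2
    + ip (x (m k) - z (m k) i) (v - z (m k) i).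
  have e0 : rho^-1 * e k @[k --> \oo] --> rho^-1 * (0 - 0 - 0 + 0).
    apply: cvgMr; apply: cvgD; first apply: cvgB; first apply: cvgB.
    + apply: (ip_cvg0 ip_norm xy (B := 1)).
      have /cvgr0Pnorm_le/(_ _ ltr01) := yz; apply: filterS => k.
      by rewrite distrC.
    + exact: sqr_norm_cvg0.
    + exact: sqr_norm_cvg0.
    + apply: (ip_cvg0 ip_norm xz (B := `|v - p| + K + 1)).
      have /cvgr0Pnorm_le/(_ _ ltr01) := xz; apply: filterS2 (sub _ KP) => k [xK _ _] xz1.
      have -> : v - z (m k) i = (v - p) - (x (m k) - p) + (x (m k) - z (m k) i).
        by rewrite opprB (addrA (v - p)) subrK addrA subrK.
      by rewrite (le_trans (ler_normD _ _))// lerD// (le_trans (ler_normB _ _))// lerD.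
  rewrite !subr0 addr0 mulr0 in e0.
  apply: (weakly_usc_left_ge (@f_usc i) Cv _ Cq yq _ e0) => k; first exact: yC.
  rewrite ler_pdivrMl//.
  exact: (extragradient_ge_at ip_norm C_convex (@f_convex i) rho_gt0 (f_lip i)
    (xC (m k)) (y_def (m k) i) (z_def (m k) i) Cv).
- split=> //; apply: (S_closed (u := t \o m)) => // [k|]; first exact: t_in.
  apply/norm_cvg0P; have [c c0 cg] := near_ge_of_limn_einf (gamma_liminf j).
  apply: (cvg0_of_sqr_le _ _ gain0); first exact: mulr_gt0 kappa_gt0 c0.
  apply: filterS (sub _ cg) => k cgk; apply: le_trans (gain_ge_Fix (m k) j).
  by rewrite -mulrA ler_wpM2l ?(ltW kappa_gt0)// distrC ler_wpM2r.
Qed.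

Lemma gain_or_VI p e : VI_solutions ip Omega F p -> 0 < e ->
  exists2 mu, 0 < mu &
    \forall n \near \oo, ip (F p) (p - t n) <= e \/ mu <= gain n.
Proof.
move=> [Op p_sol] e0; apply: contrapT => nex.
have [K [N0 _ KP]] := iterates_bounded Op.
have bad k : exists n, [/\ (maxn k N0 <= n)%N, e < ip (F p) (p - t n) &
    gain n < k.+1%:R^-1].
  apply: contrapT => nbad; apply: nex; exists k.+1%:R^-1; first by rewrite invr_gt0.
  exists (maxn k N0) => // n /= kn.
  have [|en] := lerP (ip (F p) (p - t n)) e; [by left|right].
  by rewrite leNgt; apply/negP => gn; apply: nbad; exists n.
(* A weak cluster point of [t] along [v] lies in [Omega] and violates the variational inequality by
   at least [e]. *)
have [v vP] := choice bad.
have [|q [s [s_ge tq]]] := @bounded_weakly_cvg_subseq _ _ _ ip_norm (t \o v) (K + `|p|).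
  move=> k /=; have [vk _ _] := vP k; have [_ _ tK] := KP _ (leq_trans (leq_maxr _ _) vk).
  by rewrite -(subrK p (t _)) (le_trans (ler_normD _ _))// lerD2r.
have m_ge k : (k <= v (s k))%N.
  have [vk _ _] := vP (s k).
  exact: leq_trans (s_ge k) (leq_trans (leq_maxl _ _) vk).
have gain0 : gain (v (s k)) @[k --> \oo] --> 0.
  apply: (squeeze_cvgr _ (cvg_cst 0) (@cvg_harmonic R)); apply: nearW => k.
  have [_ _ gk] := vP (s k); rewrite gain_ge0 (le_trans (ltW gk))//.
  by rewrite lef_pV2 ?posrE// ler_nat ltnS.
have Oq := weak_cluster_Omega Op m_ge gain0 tq.
have lim_ip : ip (F p) p - ip (t (v (s k))) (F p) @[k --> \oo]
    --> ip (F p) p - ip q (F p).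
  by apply: cvgB (tq (F p)); exact: cvg_cst.
have : e <= ip (F p) p - ip q (F p).
  apply: (cvgr_to_ge lim_ip); apply: nearW => k; have [_ ek _] := vP (s k).
  by rewrite (ipC _ (t _)) -ipNr -ipDr ltW.
have := p_sol _ Oq; rewrite ipDr ipNr (ipC _ q); lra.
Qed.

Lemma iterates_cvg p : VI_solutions ip Omega F p -> x n @[n --> \oo] --> p.
Proof.
move=> p_sol; have Op := p_sol.1.
have [K KP] := iterates_bounded Op; pose B := `|F p| * K.
suff s0 : `|x n - p| ^+ 2 @[n --> \oo] --> 0.
  apply/subr_cvg0; apply: (cvg0_of_sqr_le ltr01 _ s0).
  by apply: nearW => n; rewrite mul1r.
have theta_gt0 n : 0 < alpha n * eta by rewrite mulr_gt0.
apply: (@cvg0_of_descent _ (fun n => `|x n - p| ^+ 2) (fun n => alpha n * eta)).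
- by move=> n; exact: sqr_ge0.
- by move=> n; exact/ltW.
- have := @alpha_small eta^-1; rewrite invr_gt0 => /(_ eta_gt0).
  by apply: filterS => n; rewrite -ler_pdivlMr// mul1r.
- under eq_fun do rewrite -mulr_suml.
  apply/cvgryPge => A; have /cvgryPge/(_ (A / eta)) := alpha_sum.
  by apply: filterS => n; rewrite ler_pdivrMr.
(* With this level, [2 * alpha n] times it is exactly [theta n * e]. *)
move=> e e0; have ee : 0 < eta * e / 2 by rewrite divr_gt0// mulr_gt0.
have [mu mu0 muP] := gain_or_VI p_sol ee.
(* This makes a gain of [mu] outweigh the worst value of the [F p] term; the shift to [B + 2] keeps
   the denominator positive. *)
have B0 : 0 <= B + 1 -> \forall n \near \oo, 2 * alpha n * B <= mu.
  move=> B0; have mu' : 0 < mu / (2 * (B + 2)) by rewrite divr_gt0//; lra.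
  apply: filterS (alpha_small mu') => n; rewrite ler_pdivlMr; last by lra.
  by have := alpha_gt0 n; lra.
have {B0} B_le : \forall n \near \oo, 2 * alpha n * B <= mu.
  apply: B0; have [n [xK _ _]] := filter_ex KP.
  by rewrite addr_ge0// mulr_ge0// (le_trans _ xK).
apply: filterS2 (filterI muP B_le) (filterI (main_step Op) KP).
move=> n [cases muB] [[_ _ _ step] [_ _ tK]].
apply: (le_trans step); rewrite -addrA lerD2l.
have a0 := alpha_gt0 n; have g0 := gain_ge0 n.
case: cases => [ip_e|mu_gain].
  have := ler_wpM2l (ltW a0) ip_e; lra.
have ipB : ip (F p) (p - t n) <= B.
  by rewrite (le_trans (ip_le_norm ip_norm _ _))// distrC ler_wpM2l.
have := ler_wpM2l (ltW a0) ipB; have := mulr_gt0 (theta_gt0 n) e0; lra.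
Qed.

End iteration.

(** * Assembly: existence and uniqueness of the solution on [Omega], then convergence *)

Theorem theorem2 (R : realType)
  (* the real Hilbert space *)
  (H : completeNormedModType R) (ip : {dot H for @idfun R})
  (ip_norm : norm_from_ip ip)
  (C : set H) (C_neq0 : C !=set0) (C_closed : closed C) (C_convex : convex_set C)
  (N M : nat)
  (* the bifunctions *)
  (f : 'I_N -> H -> H -> R) (c1 c2 : R) (c1_gt0 : 0 < c1) (c2_gt0 : 0 < c2)
  (A1_mono : forall i, pseudomonotone C (f i))
  (A1_diag : forall i x, C x -> f i x x = 0)
  (A2 : forall i, lipschitz_type C (f i) c1 c2)
  (A3 : forall i, weakly_usc_left ip C (f i))
  (A4_convex : forall i x, C x -> convex_function C (f i x))
  (A4_subdiff : forall i x, C x -> subdifferentiable ip C (f i x))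
  (* the demicontractive mappings *)
  (S : 'I_M -> H -> H) (beta : R) (beta_ge0 : 0 <= beta) (beta_lt1 : beta < 1)
  (S_maps : forall j, set_fun C C (S j))
  (S_demi : forall j, demicontractive C beta (S j))
  (S_closed : forall j, demiclosed_at_zero ip C (S j))
  (* the operator of the variational inequality *)
  (F : H -> H) (eta L : R) (eta_gt0 : 0 < eta) (L_gt0 : 0 < L)
  (F_mono : strongly_monotone ip C eta F)
  (F_lip : L.-lipschitz_C F)
  (Omega : set H)
  (Omega_def : Omega =
     (\bigcap_(i : 'I_N) EP C (f i)) `&` (\bigcap_(j : 'I_M) Fix C (S j)))
  (Omega_neq0 : Omega !=set0)
  (* the parameters *)
  (rho : R) (rho_gt0 : 0 < rho)
  (rho_lt : rho < Num.min (1 / (2 * c1)) (1 / (2 * c2)))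
  (alpha : nat -> R) (alpha_gt0 : forall n, 0 < alpha n)
  (alpha_cvg : alpha n @[n --> \oo] --> 0)
  (alpha_sum : \sum_(1 <= k < n) alpha k @[n --> \oo] --> +oo)
  (b : nat -> 'I_M -> R) (a : R) (a_gt0 : 0 < a)
  (b_bounds : forall n j, a <= b n j /\ b n j < (1 - beta) / 2)
  (w : nat -> 'I_N -> R)
  (w_itv : forall n i, 0 < w n i /\ w n i < 1)
  (w_sum : forall n, \sum_(i < N) w n i = 1)
  (w_liminf : forall i, (0 < limn_einf (fun n => (w n i)%:E))%E)
  (gamma : nat -> 'I_M -> R)
  (gamma_itv : forall n j, 0 < gamma n j /\ gamma n j < 1)
  (gamma_sum : forall n, \sum_(j < M) gamma n j = 1)
  (gamma_liminf : forall j, (0 < limn_einf (fun n => (gamma n j)%:E))%E)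
  (* the iterates; z n i is z_n^i and zb n is z_n *)
  (x : nat -> H) (y z : nat -> 'I_N -> H) (zb t : nat -> H)
  (x0_in : C (x 0%N))
  (y_def : forall n i,
     is_argmin C (fun v => rho * f i (x n) v + 1 / 2 * `|x n - v| ^+ 2) (y n i))
  (z_def : forall n i,
     is_argmin C (fun v => rho * f i (y n i) v + 1 / 2 * `|x n - v| ^+ 2) (z n i))
  (zb_def : forall n, zb n = \sum_(i < N) w n i *: z n i)
  (t_def : forall n, t n = zb n - alpha n *: F (zb n))
  (* S j is a mapping on C: the iterations require S j (t n) to be defined *)
  (t_in : forall n, C (t n))
  (x_def : forall n, x n.+1 =
     \sum_(j < M) gamma n j *: ((1 - b n j) *: t n + b n j *: S j (t n))) :
  exists xstar : H,
    unique (VI_solutions ip Omega F) xstar /\ x n @[n --> \oo] --> xstar.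
Proof.
subst Omega.
set Omega : set H := _ `&` _ in Omega_neq0 *.
have Omega_C : Omega `<=` C by apply: Omega_sub w_sum.
have Omega_closed : closed Omega.
  apply: closedI; apply: closed_bigI => k _.
    exact: (EP_closed ip_norm C_closed (@A3 k)).
  exact: (Fix_closed ip_norm C_closed beta_lt1 (S_demi k)).
have Omega_convex : convex_set Omega.
  apply: convex_set_of_comb => p q s [fp Sp] [fq Sq] s01; split=> k _.
    apply: convex_set_comb s01; [|exact: fp|exact: fq].
    exact: (EP_convex ip_norm C_convex (@A1_mono k) (@A1_diag k) (@A3 k) (@A4_convex k)).
  apply: convex_set_comb s01; [|exact: Sp|exact: Sq].
  exact: (Fix_convex ip_norm C_convex beta_lt1 (S_demi k)).
have F_mono' : strongly_monotone ip Omega eta F.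
  by move=> u v /Omega_C Cu /Omega_C Cv; exact: F_mono.
have F_lip' : L.-lipschitz_Omega F.
  by move=> [u v] [/= /Omega_C Cu /Omega_C Cv]; exact: (F_lip (u, v)).
have [p p_sol] := VI_solutions_neq0 ip_norm Omega_closed Omega_convex Omega_neq0
  eta_gt0 L_gt0 F_mono' F_lip'.
exists p; split.
  by split=> // q q_sol; exact: (VI_solutions_unique eta_gt0 F_mono' p_sol q_sol).
have w_gt0 n i : 0 < w n i := (w_itv n i).1.
have gamma_gt0 n j : 0 < gamma n j := (gamma_itv n j).1.
exact: (iterates_cvg ip_norm C_closed C_convex c1_gt0 c2_gt0 A1_mono A2 A3 A4_convex
  beta_lt1 beta_ge0 S_maps S_demi S_closed eta_gt0 L_gt0 F_mono F_lip rho_gt0 rho_lt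
  alpha_gt0 alpha_cvg alpha_sum a_gt0 b_bounds w_gt0 w_sum w_liminf gamma_gt0 gamma_sum
  gamma_liminf x0_in y_def z_def zb_def t_def t_in x_def).
Qed.
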